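(* Let the nonlinear diffusion matrix $A(u)\in\mathbb{R}^{2\times 2}$ be positive definite. Consider the nonsymmetric direct discontinuous Galerkin (DDG) method, i.e. the scheme described in the context with model parameter $\sigma=-1$, equipped with the numerical flux $\widehat{\nabla u}$ for the gradient of the numerical solution with coefficients $(\beta_0,\beta_1)$ and the numerical flux $\widetilde{\nabla v}$ for the gradient of the test function with coefficients $(\beta_{0v},\beta_1)$. Let $u$ be its numerical solution with initial data $U_0$. If $\beta_0\ge\beta_{0v}$, then $$\int_\Omega u^2(x,y,T)\,dx\,dy\le\int_\Omega U_0^2(x,y)\,dx\,dy,\qquad\forall\, T\ge 0.$$
   Context: The equation is $\partial_t U=\nabla\cdot(A(U)\nabla U)$ on a computational domain $\Omega\subset\mathbb{R}^2$, with initial data $U_0$. $\mathcal{T}_h$ is a shape regular triangular mesh partition of $\Omega$ with $\overline\Omega=\bigcup_{K\in\mathcal{T}_h}K$; $h_K$ is the diameter of the inscribed circle of $K$; $\mathcal{E}_h$ is the set of all element edges; $h_e$ is the average of the element diameters of the elements sharing the edge $e$. The solution space is $\mathbb{V}_h^k=\{v\in L^2(\Omega): v|_K\in\mathbb{P}_k(K)\}$, where $\mathbb{P}_k(K)$ is the space of polynomials of degree $k$ in two dimensions; derivatives of functions in $\mathbb{V}_h^k$ are taken elementwise. On $\partial K$, $w^+$ and $w^-$ are the values from the exterior and interior of $K$, $[\![w]\!]=w^+-w^-$, $\{\!\{w\}\!\}=\tfrac12(w^++w^-)$, $\mathbf n=(n_1,n_2)$ is the outward unit normal, and $\boldsymbol\xi(\{\!\{u\}\!\})=A(\{\!\{u\}\!\})^T\mathbf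 n$. Fluxes: $\widehat{\nabla u}=(\widehat u_x,\widehat u_y)$ with $$\widehat u_x=\beta_0\tfrac{[\![u]\!]}{h_e}n_1+\{\!\{u_x\}\!\}+\beta_1h_e[\![u_{xx}n_1+u_{yx}n_2]\!],\quad \widehat u_y=\beta_0\tfrac{[\![u]\!]}{h_e}n_2+\{\!\{u_y\}\!\}+\beta_1h_e[\![u_{xy}n_1+u_{yy}n_2]\!],$$ and $\widetilde{\nabla v}=(\widetilde v_x,\widetilde v_y)$ with $$\widetilde v_x=\beta_{0v}\tfrac{[\![v]\!]}{h_e}n_1+\{\!\{v_x\}\!\}+\beta_1h_e[\![v_{xx}n_1+v_{yx}n_2]\!],\quad \widetilde v_y=\beta_{0v}\tfrac{[\![v]\!]}{h_e}n_2+\{\!\{v_y\}\!\}+\beta_1h_e[\![v_{xy}n_1+v_{yy}n_2]\!].$$ Scheme: find $u\in\mathbb{V}_h^k$ such that for every $K\in\mathcal{T}_h$ and all $v\in\mathbb{V}_h^k$ (the test function being taken as zero outside $K$) $$\int_K u_tv\,dx\,dy+\int_KA(u)\nabla u\cdot\nabla v\,dx\,dy-\int_{\partial K}\widehat{\nabla u}\cdot\boldsymbol\xi(\{\!\{u\}\!\})\,v\,ds+\sigma\int_{\partial K}[\![u]\!]\,\widetilde{\nabla v}\cdot\boldsymbol\xi(\{\!\{u\}\!\})\,ds=0,$$ with initial projection $\int_K u(x,y,0)v\,dx\,dy=\int_K U_0v\,dx\,dy$ for all $v\in\mathbb{V}_h^k$. Summing over all elements, the primal weak formulation is $\int_\Omega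 u_tv\,dx\,dy+\mathbb{B}(u,v)=0$ for all $v\in\mathbb{V}_h^k$, with $$\mathbb{B}(u,v)=\int_\Omega A(u)\nabla u\cdot\nabla v\,dx\,dy+\sum_{e\in\mathcal{E}_h}\int_e\big([\![v]\!]\widehat{\nabla u}+\sigma[\![u]\!]\widetilde{\nabla v}\big)\cdot\boldsymbol\xi(\{\!\{u\}\!\})\,ds.$$ *)

(* Defs.v *)
From HB Require Import structures.
From mathcomp Require Import all_boot all_order all_algebra.
From mathcomp Require Import all_classical all_reals all_analysis.
From mathcomp Require mpoly.
(* The notations of mpoly clash with those of MathComp-Analysis, so that
   {mpoly R[2]} is written mpoly 2 R and p@_m is written mcoeff m p. *)
Import -(notations) mpoly.

Set Implicit Arguments.
Unset Strict Implicit.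
Unset Printing Implicit Defensive.

Import Order.TTheory GRing.Theory Num.Theory numFieldNormedType.Exports.

Local Open Scope classical_set_scope.
Local Open Scope ring_scope.

Notation leb1 R := (@lebesgue_measure R).
Notation leb2 R := (@lebesgue_measure R \x @lebesgue_measure R)%E.

Section Plane.
Context {R : realType}.
Implicit Types (p q : R * R) (w : mpoly 2 R) (a b : 'cV[R]_2).

(* The library norm on R * R is the maximum norm. *)
Definition enorm p : R := Num.sqrt (p.1 ^+ 2 + p.2 ^+ 2).

Definition cross p q : R := p.1 * q.2 - p.2 * q.1.

Definition dot a b : R := (a^T *m b) 0 0.

(* Symmetry is not required. *)
Definition posdef (B : 'M[R]_2) : Prop :=
  forall a, a != 0 -> 0 < dot a (B *m a).

Definition evalp w p : R := meval (fun i : 'I_2 => if i == 0 then p.1 else p.2) w.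

Definition grad w p : 'cV[R]_2 := \col_j evalp (mderiv j w) p.

End Plane.

Section Triangulation.
Variables (R : realType) (elt : finType) (vtx : elt -> 'I_3 -> R * R).
Implicit Types (K : elt) (s : elt * 'I_3).

Definition tri_of K : set (R * R) :=
  [set p | exists l : 'I_3 -> R,
    [/\ forall i, 0 <= l i, \sum_i l i = 1 &
        p = (\sum_i l i * (vtx K i).1, \sum_i l i * (vtx K i).2)]].

(* A side is an edge seen from one element: side (K, i) runs from vertex i of K
   to vertex i + 1 mod 3. *)
Definition org_of s : R * R := vtx s.1 s.2.
Definition dst_of s : R * R := vtx s.1 (ordS s.2).

Definition pt_of s (r : R) : R * R :=
  ((1 - r) * (org_of s).1 + r * (dst_of s).1,
   (1 - r) * (org_of s).2 + r * (dst_of s).2).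

Definition edge_of s : set (R * R) := [set pt_of s r | r in `[0, 1]].

End Triangulation.

(* A conforming mesh of closed triangles. Vertices are listed counterclockwise,
   so that an edge shared by two elements is traversed in opposite directions.
   nbr s is the side facing s across the edge. A side facing no other element
   may still be matched with a translate of itself (periodic boundary
   conditions); nbr s = None means that s lies on the boundary of the domain and
   is not identified with anything. *)
Record mesh (R : realType) := Mesh {
  elt : finType;
  vtx : elt -> 'I_3 -> R * R;
  nbr : elt * 'I_3 -> option (elt * 'I_3);
  mesh_ccw : forall K, 0 < cross (vtx K 1 - vtx K 0) (vtx K 2 - vtx K 0);
  mesh_conforming : forall K K', K != K' ->
    [\/ tri_of vtx K `&` tri_of vtx K' = set0,
        exists i j, vtx K i = vtx K' j /\
          tri_of vtx K `&` tri_of vtx K' = [set vtx K i] |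
        exists i j, [/\ org_of vtx (K', j) = dst_of vtx (K, i),
                        dst_of vtx (K', j) = org_of vtx (K, i) &
          tri_of vtx K `&` tri_of vtx K' = edge_of vtx (K, i)]];
  nbr_shared : forall s s', org_of vtx s' = dst_of vtx s ->
    dst_of vtx s' = org_of vtx s -> nbr s = Some s';
  nbr_sym : forall s s', nbr s = Some s' -> nbr s' = Some s;
  nbr_translate : forall s s', nbr s = Some s' ->
    dst_of vtx s' - org_of vtx s' = org_of vtx s - dst_of vtx s
}.

Section DDG.
Context {R : realType} (M : mesh R).
Local Notation side := (elt M * 'I_3)%type.
Implicit Types (K : elt M) (s : side) (p q : R * R) (wi we : mpoly 2 R).

Definition tri K := tri_of (@vtx R M) K.
Definition org s := org_of (@vtx R M) s.
Definition dst s := dst_of (@vtx R M) s.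
Definition pt s r := pt_of (@vtx R M) s r.

Definition mesh_partition (Omega : set (R * R)) : Prop :=
  [/\ open Omega, closure Omega = \bigcup_K tri K &
      forall K, interior (tri K) `<=` Omega].

Definition diam K : R := sup [set enorm (pq.1 - pq.2) | pq in tri K `*` tri K].

(* Diameter of the inscribed circle: the largest circle contained in K. *)
Definition hK K : R :=
  sup [set d | 0 <= d /\
    exists c, [set p | enorm (p - c) <= d / 2] `<=` tri K].

Definition shape_regular (kappa : R) : Prop :=
  forall K, diam K <= kappa * hK K.

Definition len s : R := enorm (dst s - org s).

(* Outward because vertices are listed counterclockwise. *)
Definition normal s : 'cV[R]_2 :=
  \col_j (if j == 0 then (dst s - org s).2 / len s
          else - ((dst s - org s).1 / len s)).

Definition he s : R :=
  if nbr s is Some s' then (hK s.1 + hK s'.1) / 2 else hK s.1.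

(* Adding shift s carries the points of s to the matching points of the facing
   side; it vanishes when s is an edge shared by two elements. *)
Definition shift s : R * R := if nbr s is Some s' then org s' - dst s else 0.

Definition broken := elt M -> mpoly 2 R.

Definition Vh (k : nat) (w : broken) : Prop := forall K, (msize (w K) <= k.+1)%N.

(* w as a function on the plane; on the edges, a null set, an arbitrary one of
   the competing values is taken. *)
Definition Vh_fun (w : broken) p : R :=
  if [pick K | `[< tri K p >]] is Some K then evalp (w K) p else 0.

(* The polynomial whose values on s are the exterior values of w. On the
   boundary of the domain the exterior values are those of the extension of w
   by zero. *)
Definition ext (w : broken) s : mpoly 2 R :=
  if nbr s is Some s' then w s'.1 else 0.

(* Jump and average on s of the pair of interior and exterior polynomials. *)
Definition jump s wi we p : R := evalp we (p + shift s) - evalp wi p.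
Definition avg s wi we p : R := (evalp we (p + shift s) + evalp wi p) / 2.

Definition num_grad (b0 b1 : R) s wi we p : 'cV[R]_2 :=
  \col_j (b0 * (jump s wi we p / he s) * normal s j 0
          + avg s (mderiv j wi) (mderiv j we) p
          + b1 * he s *
            jump s (\sum_i normal s i 0 *: mderiv j (mderiv i wi))
                   (\sum_i normal s i 0 *: mderiv j (mderiv i we)) p).

Definition xi (A : R -> 'M[R]_2) (u : broken) s p : 'cV[R]_2 :=
  (A (avg s (u s.1) (ext u s) p))^T *m normal s.

Definition side_integrable s (f : R * R -> R) : Prop :=
  (leb1 R).-integrable `[0, 1] (EFin \o (f \o pt s)).

Definition side_int s (f : R * R -> R) : R :=
  len s * \int[leb1 R]_(r in `[0, 1]) f (pt s r).

Definition diffusion_term (A : R -> 'M[R]_2) (u v : broken) K p : R :=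
  dot (A (evalp (u K) p) *m grad (u K) p) (grad (v K) p).

Definition flux_term (A : R -> 'M[R]_2) (b0 b1 : R) (u v : broken) s p : R :=
  dot (num_grad b0 b1 s (u s.1) (ext u s) p) (xi A u s p) * evalp (v s.1) p.

(* The test function is zero outside the element, so that its exterior
   polynomial is 0. *)
Definition test_flux_term (A : R -> 'M[R]_2) (b0v b1 : R) (u v : broken) s p : R :=
  jump s (u s.1) (ext u s) p *
  dot (num_grad b0v b1 s (v s.1) 0 p) (xi A u s p).

Definition time_deriv (u : R -> broken) (t : R) K p : R :=
  derive1 (fun tau => evalp (u tau K) p) t.

(* No regularity of A is assumed beyond the existence of the integrals of the
   scheme; it holds for instance when A is continuous. *)
Record DDG_solution (k : nat) (A : R -> 'M[R]_2) (sigma b0 b0v b1 : R)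
    (U0 : R * R -> R) (u : R -> broken) : Prop := {
  sol_Vh : forall t : R, 0 <= t -> Vh k (u t);
  sol_continuous : forall K m,
    {within `[0, +oo[, continuous (fun t : R => mcoeff m (u t K))};
  sol_derivable : forall K m (t : R), 0 < t ->
    derivable (fun tau : R => mcoeff m (u tau K)) t 1;
  sol_integrable : forall (t : R) K v, 0 < t -> Vh k v ->
    (leb2 R).-integrable (tri K) (EFin \o diffusion_term A (u t) v K) /\
    forall i, side_integrable (K, i) (flux_term A b0 b1 (u t) v (K, i)) /\
              side_integrable (K, i) (test_flux_term A b0v b1 (u t) v (K, i));
  sol_scheme : forall (t : R) K v, 0 < t -> Vh k v ->
    \int[leb2 R]_(p in tri K) (time_deriv u t K p * evalp (v K) p)
    + \int[leb2 R]_(p in tri K) diffusion_term A (u t) v K p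
    - \sum_(i < 3) side_int (K, i) (flux_term A b0 b1 (u t) v (K, i))
    + sigma * \sum_(i < 3)
        side_int (K, i) (test_flux_term A b0v b1 (u t) v (K, i)) = 0;
  sol_init : forall K v, Vh k v ->
    (leb2 R).-integrable (tri K) (fun p => (U0 p * evalp (v K) p)%:E) /\
    \int[leb2 R]_(p in tri K) (evalp (u 0 K) p * evalp (v K) p)
    = \int[leb2 R]_(p in tri K) (U0 p * evalp (v K) p)
}.

End DDG.

(* Main.v *)
(* Take v = u in the scheme and sum over the elements. Seen from its two sides, an
   edge contributes (up to sign) [u] grad^ u . xi and [u] grad~ u . xi; since the
   method is nonsymmetric these cancel except for the penalty terms, which leave
   (beta0 - beta0v) [u]^2 / h_e (n . A n) >= 0. Hence the energy, a quadratic form in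
   the coefficients of u with the moments of the elements as coefficients, has a
   nonpositive derivative. At time 0 it is bounded through the L2 projection, and
   integrals over the domain are compared with sums over the elements using that the
   open triangles are disjoint and that edges are null. *)
Require Import Defs.
From mathcomp Require Import all_boot all_order all_algebra.
From mathcomp Require Import all_classical all_reals all_analysis.
From mathcomp Require mpoly.
From mathcomp Require Import measurable_realfun ring lra.
Import -(notations) mpoly.
Set Implicit Arguments.
Unset Strict Implicit.
Unset Printing Implicit Defensive.
Import Order.TTheory GRing.Theory Num.Theory numFieldNormedType.Exports.
Local Open Scope classical_set_scope.
Local Open Scope ring_scope.

(* lebesgue_measure lives on measurableTypeR R, whose measurable structure has
   another display than the one inferred for R; the two agree only up to
   conversion, so sets of the plane are cast when they meet the measure. *)
Local Notation plane R := (measurableTypeR R * measurableTypeR R)%type.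

(** * Triangles *)

Lemma ord3P (P : 'I_3 -> Prop) : P 0 -> P 1 -> P 2 -> forall i, P i.
Proof.
move=> P0 P1 P2 [[|[|[|//]]] lt3].
- by rewrite (_ : Ordinal _ = 0) //; apply: val_inj.
- by rewrite (_ : Ordinal _ = 1) //; apply: val_inj.
- by rewrite (_ : Ordinal _ = 2) //; apply: val_inj.
Qed.

Lemma big_ord3 (V : nmodType) (F : 'I_3 -> V) : \sum_i F i = F 0 + F 1 + F 2.
Proof.
rewrite !big_ord_recl big_ord0 addr0 addrA.
by congr (F _ + F _ + F _); apply: val_inj.
Qed.

Lemma ordS3 : (ordS 0 = 1 :> 'I_3) * (ordS 1 = 2 :> 'I_3) * (ordS 2 = 0 :> 'I_3).
Proof. by do !split; apply: val_inj. Qed.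

(** * Triangles as intersections of half-planes *)

Section Halfplanes.
Context {R : realType} (M : mesh R).
Implicit Types (K : elt M) (s : elt M * 'I_3) (p q : R * R).

(* Positive exactly on the side of s where the element lies. *)
Definition height s p : R := cross (dst s - org s) (p - org s).

(** The height over a side is twice the signed area spanned by the point and the side: the
    barycentric coordinate at the opposite vertex times [D], twice the area of the element. *)
Lemma tri_heightP K p : tri K p <-> forall i, 0 <= height (K, i) p.
Proof.
have := mesh_ccw K.
rewrite /tri /tri_of /height /org /dst /org_of /dst_of /cross /=.
case ea: (vtx K 0) => [a1 a2]; case eb: (vtx K 1) => [b1 b2].
case ec: (vtx K 2) => [c1 c2] /= Dgt0.
split.
  case=> l [l0]; rewrite !big_ord3 => l1 ->.
  rewrite ea eb ec /=.
  have := l0 0; have := l0 1; have := l0 2.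
  have -> : l 0 = 1 - l 1 - l 2 by lra.
  move=> l2p l1p l0p.
  set D := (X in 0 < X) in Dgt0; have D0 := ltW Dgt0.
  apply: ord3P; rewrite ordS3 ?ea ?eb ?ec /=.
  - by have := mulr_ge0 l2p D0; congr (_ <= _); rewrite /D; ring.
  - by have := mulr_ge0 l0p D0; congr (_ <= _); rewrite /D; ring.
  - by have := mulr_ge0 l1p D0; congr (_ <= _); rewrite /D; ring.
move=> h; have := h 0; have := h 1; have := h 2; rewrite !ordS3 ea eb ec /=.
set D := (X in 0 < X) in Dgt0; set h2 := (X in 0 <= X); move=> h2p.
set h0 := (X in 0 <= X); move=> h0p; set h1 := (X in 0 <= X); move=> h1p.
have D0 : D != 0 by rewrite gt_eqF.
(* [h2], [h0] and [h1] are the heights over sides 2, 1 and 0; the vertices opposite to these sides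
   are 1, 0 and 2. *)
pose l (i : 'I_3) : R := if i == 0 then h0 / D else if i == 1 then h2 / D else h1 / D.
have [l0 [l1 l2]] : l 0 = h0 / D /\ l 1 = h2 / D /\ l 2 = h1 / D by [].
exists l; split; rewrite ?big_ord3 ?l0 ?l1 ?l2.
- by apply: ord3P; rewrite ?l0 ?l1 ?l2 divr_ge0// ltW.
- by apply: (mulIf D0); rewrite !mulrDl !divfK// mul1r /h0 /h1 /h2 /D; ring.
- rewrite ea eb ec [LHS]surjective_pairing; congr (_, _); apply: (mulIf D0).
  + rewrite !mulrDl ![_ / D * _ * D]mulrAC !divfK// /h0 /h1 /h2 /D /=; ring.
  + rewrite !mulrDl ![_ / D * _ * D]mulrAC !divfK// /h0 /h1 /h2 /D /=; ring.
Qed.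

Definition open_tri K : set (R * R) := [set p | forall i, 0 < height (K, i) p].

Lemma height_pt s r : height s (pt s r) = 0.
Proof.
rewrite /height /pt /pt_of /cross /= -/(org s) -/(dst s); ring.
Qed.

Lemma height_org s : height s (org s) = 0.
Proof. by rewrite /height /cross /= !subrr !mulr0 subrr. Qed.

Lemma open_tri_sub K : open_tri K `<=` tri K.
Proof. by move=> p hp; apply/tri_heightP => i; rewrite ltW. Qed.

(** By conformity, common points form at most a vertex or an edge of [K], and every such point has
    height 0 over some side of [K]. *)
Lemma open_tri_disjoint K K' p : K != K' -> open_tri K p -> ~ open_tri K' p.
Proof.
move=> KK' hp hp'.
have pI : (tri_of (@vtx R M) K `&` tri_of (@vtx R M) K') p.
  by split; apply: open_tri_sub.
case: (mesh_conforming KK') => [e|[i [j [_ e]]]|[i [j [_ _ e]]]].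
- by rewrite e in pI.
- rewrite e in pI; have := hp i.
  by rewrite pI (_ : vtx K i = org (K, i))// height_org ltxx.
- rewrite e in pI; case: pI => r _ rp; have := hp i.
  by rewrite -rp (height_pt (K, i)) ltxx.
Qed.

Lemma heightE s : height s = fun p : R * R =>
  (dst s - org s).1 * (p.2 - (org s).2) - (dst s - org s).2 * (p.1 - (org s).1).
Proof. by []. Qed.

Lemma continuous_height s : continuous (height s).
Proof.
rewrite heightE => p.
apply: cvgB; (apply: cvgM; first exact: cvg_cst); (apply: cvgB; last exact: cvg_cst).
  exact: cvg_snd.
exact: cvg_fst.
Qed.

Lemma open_tri_interior K : open_tri K `<=` interior (tri K).
Proof.
rewrite -open_subsetE; first exact: open_tri_sub.
have openU i : open [set p | 0 < height (K, i) p].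
  apply: (@open_comp _ _ (height (K, i)) [set x | 0 < x]); last exact: open_gt.
  by move=> p _; exact: continuous_height.
rewrite (_ : open_tri K = [set p | 0 < height (K, 0) p] `&`
    [set p | 0 < height (K, 1) p] `&` [set p | 0 < height (K, 2) p]).
  exact: openI (openI _ _) _.
by apply/seteqP; split=> p => [h|[[h0 h1] h2]]; [do !split; exact: h|exact: ord3P].
Qed.

Lemma measurable_height s : measurable_fun [set: R * R] (height s).
Proof.
rewrite heightE.
apply: measurable_funB; (apply: measurable_funM; first exact: measurable_cst);
  (apply: measurable_funB; last exact: measurable_cst).
- exact: measurable_snd.
- exact: measurable_fst.
Qed.

Lemma measurable_tri K : measurable (tri K : set (plane R)).
Proof.
rewrite (_ : tri K = \bigcap_(i in [set: 'I_3]) (height (K, i) @^-1` `[0, +oo[)).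
  apply: fin_bigcap_measurable => // i _; rewrite -[X in measurable X]setTI.
  exact: measurable_height.
by apply/seteqP; split=> p => [/tri_heightP h i _|h]; [|apply/tri_heightP => i; have := h i I];
  rewrite /= in_itv/= andbT.
Qed.

Lemma measurable_open_tri K : measurable (open_tri K : set (plane R)).
Proof.
rewrite (_ : open_tri K = \bigcap_(i in [set: 'I_3]) (height (K, i) @^-1` `]0, +oo[)).
  apply: fin_bigcap_measurable => // i _; rewrite -[X in measurable X]setTI.
  exact: measurable_height.
by apply/seteqP; split=> p h i => [_|]; [|have := h i I];
  rewrite /= in_itv/= andbT.
Qed.

End Halfplanes.

(** A vertical line is a point times the real line; any other line meets each vertical line in one
    point, so its area is an iterated integral of zero. *)
Lemma line_null {R : realType} (a b c : R) : (a, b) != (0, 0) ->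
  leb2 R [set p | a * p.1 + b * p.2 = c] = 0%E.
Proof.
move=> ab.
have [b0|b0] := eqVneq b 0.
  have a0 : a != 0 by apply: contraNneq ab => ->; rewrite b0.
  rewrite (_ : [set _ | _] = [set c / a] `*` setT).
    have -> := @product_measure1E _ _ _ _ R (leb1 R) (leb1 R) [set c / a] setT.
    (* The other factor is infinite, and 0 times +oo is 0. *)
    - by rewrite [X in (X * _)%E](_ : _ = 0%E) ?mul0e//; exact: lebesgue_measure_set1.
    - exact: measurable_set1.
    - exact: measurableT.
  apply/seteqP; split=> -[x y] /=; rewrite b0 mul0r addr0.
    by move=> <-; rewrite mulrC mulKf.
  by move=> [-> _]; rewrite mulrC divfK.
rewrite /product_measure1 integral0_eq// => x _ /=.
apply/eqP; rewrite eq_le measure_ge0 andbT.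
rewrite -(lebesgue_measure_set1 ((c - a * x) / b)).
apply: le_outer_measure.
move=> y; rewrite /xsection /= inE /= => <-.
by rewrite addrC addKr mulrC mulKf.
Qed.

(** * Measure and integration on the elements *)

Section MeshMeasure.
Context {R : realType} (M : mesh R).
Implicit Types (K : elt M) (s : elt M * 'I_3) (p q : R * R).

Lemma height_null s : leb2 R [set p | height s p = 0] = 0%E.
Proof.
rewrite -(@line_null R (- (dst s - org s).2) (dst s - org s).1
  ((dst s - org s).1 * (org s).2 - (dst s - org s).2 * (org s).1)).
  congr (_ _); apply/seteqP; split=> p /=; rewrite heightE; lra.
(* The ends of the side are distinct: equal ones would give the element zero area, against
   [mesh_ccw]. *)
rewrite xpair_eqE oppr_eq0; apply/negP => /andP[/eqP d2 /eqP d1].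
have d0 : dst s = org s.
  by apply/eqP; rewrite -subr_eq0 [_ - _]surjective_pairing d1 d2.
have := mesh_ccw s.1; move: d0; rewrite /dst /org /dst_of /org_of.
case: s {d1 d2} => K i /=; move: i; apply: ord3P; rewrite !ordS3 /cross /= => ->;
  rewrite ?subrr /=; lra.
Qed.

Lemma tri_bounded K : exists B : R, 0 <= B /\ tri K `<=` `[- B, B] `*` `[- B, B].
Proof.
exists (\sum_i (`|(vtx K i).1| + `|(vtx K i).2|)); split.
  by apply: sumr_ge0 => i _; rewrite addr_ge0.
have le1 (l : 'I_3 -> R) i : (forall i, 0 <= l i) -> \sum_i l i = 1 -> l i <= 1.
  by move=> l0 <-; rewrite (bigD1 i)//= lerDl sumr_ge0.
move=> p [l [l0 l1 ->]]; split; rewrite /= in_itv/= -ler_norml.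
- apply: (le_trans (ler_norm_sum _ _ _)); apply: ler_sum => i _.
  rewrite normrM (ger0_norm (l0 i)); apply: (@le_trans _ _ `|(vtx K i).1|).
    by rewrite ler_piMl// le1.
  by rewrite lerDl.
- apply: (le_trans (ler_norm_sum _ _ _)); apply: ler_sum => i _.
  rewrite normrM (ger0_norm (l0 i)); apply: (@le_trans _ _ `|(vtx K i).2|).
    by rewrite ler_piMl// le1.
  by rewrite lerDr.
Qed.

Lemma tri_measure_lty K : (leb2 R (tri K) < +oo)%E.
Proof.
have [B [B0 sB]] := tri_bounded K.
have mI : measurable (`[- B, B]%classic : set R) by exact: measurable_itv.
apply: (@le_lt_trans _ _ (leb2 R (`[- B, B] `*` `[- B, B]))).
  by apply: le_measure => //; rewrite inE; [exact: measurable_tri|exact: measurableX].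
have -> := @product_measure1E _ _ _ _ R (leb1 R) (leb1 R) _ _ mI mI.
by rewrite lte_mul_pinfty// ?ge0_fin_numE//= lebesgue_measure_itv/=; case: ifP; rewrite ?ltry.
Qed.

Lemma bounded_integrable_tri K (f : R * R -> R) : measurable_fun (tri K) f ->
  (exists C, forall p, tri K p -> `|f p| <= C) ->
  (leb2 R).-integrable (tri K) (EFin \o f).
Proof.
move=> mf [C fC]; apply: measurable_bounded_integrable => //.
- exact: measurable_tri.
- exact: tri_measure_lty.
- exists C; split; first exact: num_real.
  by move=> x Cx p Kp; rewrite /= (le_trans (fC p Kp))// ltW.
Qed.

(* The edges are null. *)
Lemma ge0_integral_open_tri K (f : R * R -> \bar R) :
  measurable_fun (tri K) f -> (forall p, tri K p -> 0 <= f p)%E ->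
  (\int[leb2 R]_(p in tri K) f p = \int[leb2 R]_(p in open_tri K) f p)%E.
Proof.
move=> mf f0.
have mN i : measurable [set p : R * R | height (K, i) p = 0].
  have := measurable_height (K, i) measurableT (measurable_set1 0); rewrite setTI.
exact.
have drop i (D : set (R * R)) : measurable D -> D `<=` tri K ->
    (\int[leb2 R]_(p in D) f p
     = \int[leb2 R]_(p in D `\` [set p | height (K, i) p = 0%R]) f p)%E.
  move=> mD DK; apply: ge0_negligible_integral => //.
  - exact: mN.
  - exact: measurable_funS (measurable_tri K) DK mf.
  - by move=> p /DK/f0.
  - exact: height_null.
have mK := measurable_tri K.
rewrite (drop 0)// (drop 1); last 2 first.
- exact: measurableD.
- by move=> p [].
rewrite (drop 2); last 2 first.
- by apply: measurableD => //; exact: measurableD.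
- by move=> p [[]].
congr (integral _ _ _); apply/seteqP; split=> p.
  move=> [[[/tri_heightP h n0] n1] n2]; apply: ord3P; rewrite lt0r h andbT; exact/eqP.
move=> h; split; [split; [split|]|]; try (by move/eqP; apply/negP; rewrite gt_eqF).
exact: open_tri_sub.
Qed.
End MeshMeasure.

(** * Edges *)

Section Reflection.
Context {R : realType}.
Let refl : measurableTypeR R -> measurableTypeR R := fun r : R => 1 - r.

Let mrefl : measurable_fun [set: measurableTypeR R] refl.
Proof. by apply: measurable_funB; [exact: measurable_cst|exact: measurable_id]. Qed.

(** By uniqueness of Lebesgue measure it is enough to compare on half-open intervals; reflection
    exchanges the closed and the open end and keeps the length. *)
Lemma pushforward_lebesgue_onem (A : set R) : measurable A ->
  pushforward (leb1 R) refl A = leb1 R A.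
Proof.
move=> mA; apply/esym/lebesgue_measure_unique => //= _ [[a b]] _ <-.
rewrite /pushforward (_ : refl @^-1` _ = `[1 - b, 1 - a[%classic).
  rewrite !lebesgue_measure_itv/= !lte_fin ltrD2l ltrN2.
  by case: ifP => // _; rewrite -!EFinB; congr EFin; ring.
by apply/seteqP; split=> r; rewrite /refl /= !in_itv/= => /andP[h1 h2]; apply/andP; split; lra.
Qed.

Let I01 : set R := `[0, 1]%classic.
Let refl01 : refl @^-1` I01 = I01.
Proof.
by apply/seteqP; split=> r; rewrite /refl /I01 /= !in_itv/= => /andP[h1 h2]; apply/andP; split; lra.
Qed.

(** Facing sides are parametrized in opposite directions; this change of variables brings their
    integrals to a common parameter. *)
Lemma integrable_onem (g : R -> R) : (leb1 R).-integrable `[0, 1] (EFin \o g) ->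
  (leb1 R).-integrable `[0, 1] (EFin \o (fun r => g (1 - r))) /\
  \int[leb1 R]_(r in `[0, 1]) g (1 - r) = \int[leb1 R]_(r in `[0, 1]) g r.
Proof.
move=> ig.
have mI : measurable I01 by exact: measurable_itv.
(* Cutting off outside the interval gives a function measurable on the whole line, as the
   pushforward formula asks; on the interval [f \o refl] is [g]. *)
pose f : R -> \bar R := (EFin \o (fun r => g (1 - r))) \_ I01.
have fE r : I01 r -> f (refl r) = (g r)%:E.
  move=> Ir; rewrite /f patchE ifT /=; first by rewrite /refl opprB addrC subrK.
  by rewrite inE -[I01]refl01 /refl /= opprB addrC subrK.
have mf : measurable_fun [set: measurableTypeR R] f.
  apply/measurable_restrict => //; rewrite ?setTI.
  apply: (@measurable_comp _ _ _ _ _ _ I01 (EFin \o g) I01 refl mI).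
  - by move=> _ [r Ir <-]; rewrite -[I01 _]/((refl @^-1` I01) r) refl01.
  - exact: measurable_int ig.
  - exact: measurable_funTS.
have if_ : (leb1 R).-integrable (refl @^-1` I01) (f \o refl).
  rewrite refl01; apply: eq_integrable ig => // r.
  by rewrite inE => Ir; rewrite /= fE.
have eqm (A : set R) : measurable A -> A `<=` I01 -> pushforward (leb1 R) refl A = leb1 R A.
  by move=> mA _; exact: pushforward_lebesgue_onem.
have eqI : (\int[leb1 R]_(r in I01) f r = \int[leb1 R]_(r in I01) (g r)%:E)%E.
  transitivity (\int[pushforward (leb1 R) refl]_(r in I01) f r)%E.
    by apply: eq_measure_integral => A mA sA; exact/esym/eqm.
  rewrite (integral_pushforward mrefl mf if_ mI) refl01.
  by apply: eq_integral => r; rewrite inE => Ir; rewrite /= fE.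
have fI r : I01 r -> f r = (g (1 - r))%:E by move=> Ir; rewrite /f patchE ifT// inE.
have if' : (leb1 R).-integrable I01 f.
  have /integrableP[_ fin] := integrable_pushforward mrefl mf if_ mI.
  apply/integrableP; split; first exact: measurable_funTS.
  apply: le_lt_trans fin; rewrite le_eqVlt; apply/orP; left; apply/eqP.
  by apply: eq_measure_integral => A mA sA; exact/esym/eqm.
split; first by apply: eq_integrable if' => // r; rewrite inE => /fI.
rewrite /Rintegral -eqI; congr fine; apply: eq_integral => r.
by rewrite inE => /fI.
Qed.
End Reflection.

Lemma Rintegral_le0 d (T : measurableType d) (R : realType)
    (mu : {measure set T -> \bar R}) (D : set T) (f : T -> R) :
  (forall x, D x -> f x <= 0) -> \int[mu]_(x in D) f x <= 0.
Proof.
move=> f0; rewrite /Rintegral.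
under eq_integral do rewrite -[f _]opprK EFinN.
rewrite integral_ge0N; last by move=> x /f0; rewrite lee_fin oppr_ge0.
(* [fine] sends an infinite integral to 0, so the sign survives. *)
by rewrite fineN oppr_le0 fine_ge0// integral_ge0// => x /f0; rewrite lee_fin oppr_ge0.
Qed.

(** * Evaluation of polynomials and quadratic forms *)

Section Evaluation.
Context {R : realType}.
Implicit Types (p q : R * R) (v w : mpoly 2 R).

Lemma evalp0 p : evalp 0 p = 0.
Proof. exact: meval0. Qed.

Lemma evalpD v w p : evalp (v + w) p = evalp v p + evalp w p.
Proof. exact: mevalD. Qed.

Lemma evalpZ (a : R) w p : evalp (a *: w) p = a * evalp w p.
Proof. exact: mevalZ. Qed.

Lemma evalp_sum (I : Type) (r : seq I) (P : pred I) (F : I -> mpoly 2 R) p :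
  evalp (\sum_(i <- r | P i) F i) p = \sum_(i <- r | P i) evalp (F i) p.
Proof.
by elim/big_rec2: _ => [|i x y _ <-]; [exact: evalp0|exact: evalpD].
Qed.

Lemma mderiv_0 (i : 'I_2) : mderiv i (0 : mpoly 2 R) = 0.
Proof. exact: raddf0. Qed.

Lemma dotE (a b : 'cV[R]_2) : dot a b = a 0 0 * b 0 0 + a 1 0 * b 1 0.
Proof.
rewrite /dot mxE !big_ord_recl big_ord0 addr0 !mxE.
by congr (a _ _ * b _ _ + a _ _ * b _ _); apply: val_inj.
Qed.

Lemma dotC (a b : 'cV[R]_2) : dot a b = dot b a.
Proof. by rewrite !dotE; congr (_ + _); rewrite mulrC. Qed.

Lemma posdef_ge0 (B : 'M[R]_2) a : posdef B -> 0 <= dot a (B *m a).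
Proof.
move=> pB; have [->|/pB/ltW//] := eqVneq a 0.
by rewrite mulmx0 dotE !mxE !mul0r addr0.
Qed.

Lemma dot_trmx (B : 'M[R]_2) a b : dot a (B^T *m b) = dot b (B *m a).
Proof.
by rewrite /dot -[in LHS](trmxK (B^T *m b)) -trmx_mul mxE trmx_mul !trmxK mulmxA.
Qed.
End Evaluation.

(** * Signs of the edge contributions *)

Section Edges.
Context {R : realType} (M : mesh R).
Local Notation side := (elt M * 'I_3)%type.
Implicit Types (K : elt M) (s : side) (p q : R * R).

Lemma hK_ge0 K : 0 <= hK K.
Proof.
(* [sup] is 0 by convention on empty and on unbounded sets; otherwise it dominates a nonnegative
   member. *)
rewrite /hK; set S := (X in sup X); have [->|S0] := eqVneq S set0; first by rewrite sup0.
have [ubS|nub] := pselect (has_ubound S); last by rewrite sup_out// => -[].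
move/set0P: S0 => [d Sd]; apply: (@le_trans _ _ d); first by case: Sd.
exact: ub_le_sup.
Qed.

Lemma he_ge0 s : 0 <= he s.
Proof.
rewrite /he; case: (nbr s) => [s'|]; last exact: hK_ge0.
by rewrite divr_ge0// addr_ge0// hK_ge0.
Qed.

Section Facing.
Variables (s s' : side) (nss' : nbr s = Some s').

Lemma nbr_he : he s' = he s.
Proof. by rewrite /he nss' (nbr_sym nss') addrC. Qed.

Let tr : dst s' - org s' = - (dst s - org s).
Proof. by rewrite opprB; exact: nbr_translate nss'. Qed.

Lemma nbr_len : len s' = len s.
Proof. by rewrite /len tr /enorm /= !sqrrN. Qed.

Lemma nbr_normal : normal s' = - normal s.
Proof.
apply/matrixP => j k; rewrite !mxE tr nbr_len /=.
by case: ifP => _; rewrite ?mulNr.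
Qed.

Let dst_nbr : dst s' = ((org s').1 - (dst s - org s).1, (org s').2 - (dst s - org s).2).
Proof.
by move: tr => /(congr1 (+%R^~ (org s'))); rewrite subrK [RHS]addrC.
Qed.

Lemma nbr_pt r : pt s r + Defs.shift s = pt s' (1 - r).
Proof.
rewrite /Defs.shift nss' /pt /pt_of -/(org s) -/(dst s) -/(org s') -/(dst s') dst_nbr.
by rewrite [LHS]surjective_pairing /=; congr (_, _); ring.
Qed.

Lemma nbr_shift r : pt s' (1 - r) + Defs.shift s' = pt s r.
Proof.
rewrite /Defs.shift (nbr_sym nss') /pt /pt_of -/(org s) -/(dst s) -/(org s') -/(dst s') dst_nbr.
by rewrite [LHS]surjective_pairing /=; congr (_, _); ring.
Qed.
End Facing.

Variables (A : R -> 'M[R]_2) (b0 b0v b1 : R).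
Hypotheses (posA : forall z, posdef (A z)) (leb : b0v <= b0).

(** For sigma = -1 both boundary integrals enter the scheme with a minus sign; this is the sum of
    their integrands, tested with [w] itself. *)
Definition edge_term (w : broken M) s p : R :=
  flux_term A b0 b1 w w s p + test_flux_term A b0v b1 w w s p.

(** [xi] carries the transpose of A, but n . A^T n = n . A n. *)
Lemma normal_xi_ge0 w s p : 0 <= dot (normal s) (xi A w s p).
Proof. by rewrite /xi dot_trmx; exact: posdef_ge0. Qed.

(** The normal is constant along a side and can leave the jump; reversing it is then a mere change
    of sign that [ring] can follow. *)
Lemma num_gradE b s wi we p (j : 'I_2) : num_grad b b1 s wi we p j 0 =
  b * (jump s wi we p / he s) * normal s j 0
  + avg s (mderiv j wi) (mderiv j we) p
  + b1 * he s * \sum_i normal s i 0 *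
      jump s (mderiv j (mderiv i wi)) (mderiv j (mderiv i we)) p.
Proof.
rewrite mxE; congr (_ + _ * _); rewrite /jump !evalp_sum -sumrB.
by apply: eq_bigr => i _; rewrite !evalpZ mulrBr.
Qed.

(** The exterior value is 0, so the jump is -u, and the two numerical gradients differ only in the
    penalty. What is left is -(b0 - b0v) u^2 / he times n . xi. *)
Lemma edge_term_boundary w s p : nbr s = None -> edge_term w s p <= 0.
Proof.
move=> ns; rewrite /edge_term /flux_term /test_flux_term /ext ns.
have := normal_xi_ge0 w s p; rewrite !dotE !num_gradE.
set nx := (X in 0 <= X) => nx0.
rewrite (_ : jump s (w s.1) 0 p = - evalp (w s.1) p) ?/jump ?evalp0 ?sub0r//.
(* This product is exactly minus the edge term, so [ring] closes the gap. *)
have dissip := mulr_ge0 (mulr_ge0 (ltac:(by rewrite subr_ge0) : 0 <= b0 - b0v)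
  (mulr_ge0 (sqr_ge0 (evalp (w s.1) p)) (ltac:(by rewrite invr_ge0 he_ge0) : 0 <= (he s)^-1))) nx0.
rewrite -oppr_ge0; apply: (le_trans dissip); rewrite le_eqVlt; apply/orP; left; apply/eqP.
rewrite /nx; ring.
Qed.

(** Seen from [s'] the numerical gradient of [w] is unchanged while [xi] changes sign, and the two
    test gradients, each extended by zero, add up to the two-sided one. Only the penalties do not
    cancel: they leave -(b0 - b0v) (b - a)^2 / he times n . xi. *)
Lemma edge_term_facing w s s' r : nbr s = Some s' ->
  edge_term w s (pt s r) + edge_term w s' (pt s' (1 - r)) <= 0.
Proof.
move=> nss'; rewrite /edge_term /flux_term /test_flux_term /ext nss' (nbr_sym nss').
have := normal_xi_ge0 w s (pt s r).
have -> : xi A w s' (pt s' (1 - r)) = - xi A w s (pt s r).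
  rewrite /xi (nbr_normal nss') mulmxN; congr (- ((A _)^T *m _)).
  by rewrite /avg /ext nss' (nbr_sym nss') (nbr_shift nss') (nbr_pt nss') addrC.
have oppE (v : 'cV[R]_2) j : (- v) j 0 = - v j 0 by rewrite mxE.
rewrite !dotE !num_gradE /jump /avg !(nbr_shift nss') !(nbr_pt nss').
rewrite !(nbr_he nss') !(nbr_normal nss').
rewrite !oppE !big_ord_recl !big_ord0 !mderiv_0 !evalp0 !oppE.
set nx := (X in 0 <= X) => nx0.
set a := evalp (w s.1) (pt s r); set b := evalp (w s'.1) (pt s' (1 - r)).
have dissip := mulr_ge0 (mulr_ge0 (ltac:(by rewrite subr_ge0) : 0 <= b0 - b0v)
  (mulr_ge0 (sqr_ge0 (b - a)) (ltac:(by rewrite invr_ge0 he_ge0) : 0 <= (he s)^-1))) nx0.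
rewrite -oppr_ge0; apply: (le_trans dissip); rewrite le_eqVlt; apply/orP; left; apply/eqP.
rewrite /nx; ring.
Qed.
Lemma side_int_boundary w s : nbr s = None -> side_int s (edge_term w s) <= 0.
Proof.
move=> ns; rewrite mulr_ge0_le0 ?sqrtr_ge0// Rintegral_le0// => r _.
by rewrite edge_term_boundary.
Qed.

Lemma side_int_facing w s s' : nbr s = Some s' ->
  side_integrable s (edge_term w s) -> side_integrable s' (edge_term w s') ->
  side_int s (edge_term w s) + side_int s' (edge_term w s') <= 0.
Proof.
move=> nss' is_ is'; rewrite /side_int (nbr_len nss') -mulrDr.
have [ir <-] := integrable_onem is'.
have mI : measurable (`[0, 1]%classic : set (measurableTypeR R)) by exact: measurable_itv.
rewrite -(RintegralD mI is_ ir).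
rewrite mulr_ge0_le0 ?sqrtr_ge0// Rintegral_le0// => r _.
by rewrite edge_term_facing.
Qed.

Lemma sum_side_int_le0 w : (forall s, side_integrable s (edge_term w s)) ->
  \sum_s side_int s (edge_term w s) <= 0.
Proof.
move=> ew; set I := fun s => side_int s (edge_term w s).
(* An unmatched side is its own face. Adding the sum to its reindexing by [face] pairs facing sides
   without choosing a representative of each edge. *)
pose face s := odflt s (nbr s).
have faceK : involutive face.
  move=> s; rewrite /face; case ns: (nbr s) => [s'|] /=; last by rewrite ns.
  by rewrite (nbr_sym ns).
suff : \sum_s I s + \sum_s I s <= 0 by lra.
rewrite [X in _ + X](reindex_inj (inv_inj faceK)) -big_split /= sumr_le0// => s _.
rewrite /face; case ns: (nbr s) => [s'|] /=; first exact: side_int_facing.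
by have := side_int_boundary w ns; rewrite -/(I s); lra.
Qed.
End Edges.

(** * Energy *)

Section Polynomials.
Context {R : realType} (M : mesh R).
Implicit Types (K : elt M) (p : R * R) (v w : mpoly 2 R).

Lemma evalpM v w p : evalp (v * w) p = evalp v p * evalp w p.
Proof. exact: mevalM. Qed.

Lemma evalpE w p :
  evalp w p = \sum_(m <- msupp w) mcoeff m w * (p.1 ^+ m 0 * p.2 ^+ m 1).
Proof.
rewrite /evalp mevalE; apply: eq_bigr => m _; congr (_ * _).
rewrite !big_ord_recl big_ord0 mulr1 /=; congr (_ * _ ^+ fun_of_multinom m _).
exact: val_inj.
Qed.

Lemma measurable_evalp w : measurable_fun [set: R * R] (evalp w).
Proof.
rewrite (_ : evalp w = fun p : R * R =>
    \sum_(m <- msupp w) mcoeff m w * (p.1 ^+ m 0 * p.2 ^+ m 1)); last first.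
  by apply/funext => p; exact: evalpE.
apply: measurable_sum => m; apply: measurable_funM; first exact: measurable_cst.
apply: measurable_funM; apply: measurable_funX; [exact: measurable_fst|exact: measurable_snd].
Qed.

Lemma evalp_bounded K w : exists C, forall p, tri K p -> `|evalp w p| <= C.
Proof.
have [B [B0 KB]] := tri_bounded K.
exists (\sum_(m <- msupp w) `|mcoeff m w| * (B ^+ m 0 * B ^+ m 1)) => p /KB.
case; rewrite /= !in_itv /= -!ler_norml => p1 p2.
rewrite evalpE; apply: (le_trans (ler_norm_sum _ _ _)); apply: ler_sum => m _.
rewrite !normrM !normrX ler_wpM2l// ler_pM ?exprn_ge0// lerXn2r ?nnegrE//.
Qed.

Lemma integrable_evalp K w : (leb2 R).-integrable (tri K) (EFin \o evalp w).
Proof.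
apply: bounded_integrable_tri; last exact: evalp_bounded.
exact: measurable_funTS (measurable_evalp w).
Qed.

Definition tri_int K w : R := \int[leb2 R]_(p in tri K) evalp w p.

Lemma tri_intD K v w : tri_int K (v + w) = tri_int K v + tri_int K w.
Proof.
rewrite /tri_int -(RintegralD (measurable_tri K) (integrable_evalp K v) (integrable_evalp K w)).
by apply: eq_Rintegral => p _; exact: evalpD.
Qed.

Lemma tri_intZ K (a : R) w : tri_int K (a *: w) = a * tri_int K w.
Proof.
rewrite /tri_int -(RintegralZl a (measurable_tri K) (integrable_evalp K w)).
by apply: eq_Rintegral => p _; exact: evalpZ.
Qed.

Lemma tri_int_sum K (I : Type) (r : seq I) (F : I -> mpoly 2 R) :
  tri_int K (\sum_(i <- r) F i) = \sum_(i <- r) tri_int K (F i).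
Proof.
elim/big_rec2: _ => [|i x y _ <-]; last exact: tri_intD.
by rewrite -(scale0r (0 : mpoly 2 R)) tri_intZ mul0r.
Qed.

(** [msize] is the degree plus one, and the sum runs over monomials of degree below k + 1. Unlike
    the support of [w K], this index set stays fixed in time, so that coefficients can be
    differentiated. *)
Lemma Vh_expand k (w : broken M) K : Vh k w ->
  w K = \sum_(m : bmultinom 2 k.+1) mcoeff m (w K) *: mpolyX R m.
Proof. by move=> Vw; exact: mpolywE. Qed.

End Polynomials.

(** * Derivatives and continuity of finite sums *)

Section Calculus.
Context {R : realType}.

Lemma is_derive_big (I : Type) (r : seq I) (F : I -> R -> R) (dF : I -> R) (t : R) :
  (forall i, is_derive t 1 (F i) (dF i)) ->
  is_derive t 1 (fun x => \sum_(i <- r) F i x) (\sum_(i <- r) dF i).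
Proof.
move=> dFi; elim: r => [|i r IH].
  rewrite big_nil (_ : (fun x => _) = cst 0); first exact: is_derive_cst.
  by apply/funext => x; rewrite big_nil.
rewrite big_cons (_ : (fun x => _) = F i \+ (fun x => \sum_(j <- r) F j x)).
  exact: is_deriveD.
by apply/funext => x; rewrite big_cons.
Qed.

Lemma continuous_big (T : topologicalType) (I : Type) (r : seq I) (F : I -> T -> R) :
  (forall i, continuous (F i)) -> continuous (fun x => \sum_(i <- r) F i x).
Proof.
move=> cF; elim: r => [|i r IH].
  rewrite (_ : (fun x => _) = cst 0); first by move=> x; exact: cvg_cst.
  by apply/funext => x; rewrite big_nil.
rewrite (_ : (fun x => _) = F i \+ (fun x => \sum_(j <- r) F j x)).
  by move=> x; apply: continuousD; [exact: cF|exact: IH].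
by apply/funext => x; rewrite big_cons.
Qed.
End Calculus.

(** * Decay of the energy *)

Section Energy.
Context {R : realType} (M : mesh R) (k : nat) (A : R -> 'M[R]_2)
  (b0 b0v b1 : R) (U0 : R * R -> R) (u : R -> broken M).
Hypotheses (posA : forall z, posdef (A z)) (leb : b0v <= b0).
Hypothesis solu : DDG_solution k A (-1) b0 b0v b1 U0 u.

Local Notation mon := (bmultinom 2 k.+1).
Let c (K : elt M) (m : mon) (t : R) : R := mcoeff m (u t K).
(** The time derivative as a broken polynomial, so that integrals against it are [tri_int] of a
    product. *)
Let du (t : R) : broken M := fun K => \sum_(m : mon) derive1 (c K m) t *: mpolyX R m.

Lemma time_derivE (t : R) K p : 0 < t -> time_deriv u t K p = evalp (du t K) p.
Proof.
move=> t0; rewrite /time_deriv /du evalp_sum derive1E.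
pose f x := \sum_(m : mon) c K m x * evalp (mpolyX R m) p.
(* The expansion in monomials is available at nonnegative times, hence in a neighbourhood of [t]. *)
rewrite (_ : 'D_1 _ t = 'D_1 f t); last first.
  apply: near_eq_derive; near=> x.
  have x0 : 0 < x by near: x; exact: lt_nbhsr.
  rewrite (Vh_expand K (sol_Vh solu (ltW x0))) evalp_sum.
  by apply: eq_bigr => m _; exact: evalpZ.
have dc m : is_derive t 1 (fun x => c K m x * evalp (mpolyX R m) p)
    (derive1 (c K m) t * evalp (mpolyX R m) p).
  have cd : is_derive t 1 (c K m) (derive1 (c K m) t).
    by apply: DeriveDef; [exact: sol_derivable solu _ _ _ t0|rewrite derive1E].
  apply: (@is_derive_eq _ _ _ _ _ _ _ _
    (is_deriveM cd (is_derive_cst (evalp (mpolyX R m) p) t 1))).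
  by rewrite scaler0 add0r /GRing.scale /= mulrC.
have -> := @derive_val _ _ _ _ _ _ _ (is_derive_big (index_enum mon) dc).
by apply: eq_bigr => m _; rewrite evalpZ.
Unshelve. all: by end_near.
Qed.

(** The squared L2 norm with the squares expanded: a finite sum in the coefficients, so no limit has
    to pass under an integral. *)
Definition energy (t : R) : R :=
  \sum_K \sum_(m : mon) \sum_(m' : mon)
    c K m t * c K m' t * tri_int K (mpolyX R m * mpolyX R m').

Lemma tri_int_product (K : elt M) (a b : mon -> R) :
  tri_int K ((\sum_m a m *: mpolyX R m) * (\sum_m b m *: mpolyX R m)) =
  \sum_m \sum_m' a m * b m' * tri_int K (mpolyX R m * mpolyX R m').
Proof.
rewrite mulr_suml tri_int_sum; apply: eq_bigr => m _.
rewrite mulr_sumr tri_int_sum; apply: eq_bigr => m' _.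
by rewrite -scalerAl -scalerAr scalerA tri_intZ.
Qed.

Lemma energyE (t : R) : 0 <= t -> energy t = \sum_K tri_int K (u t K ^+ 2).
Proof.
move=> t0; apply: eq_bigr => K _.
by rewrite expr2 (Vh_expand K (sol_Vh solu t0)) tri_int_product.
Qed.

Lemma is_derive_energy (t : R) : 0 < t ->
  is_derive t 1 energy (2 * \sum_K tri_int K (du t K * u t K)).
Proof.
move=> t0; pose G (K : elt M) (m m' : mon) := tri_int K (mpolyX R m * mpolyX R m').
have dc K m : is_derive t 1 (c K m) (derive1 (c K m) t).
  by apply: DeriveDef; [exact: sol_derivable solu _ _ _ t0|rewrite derive1E].
have dcc K m m' : is_derive t 1 (fun x => c K m x * c K m' x * G K m m')
    ((c K m t * derive1 (c K m') t + c K m' t * derive1 (c K m) t) * G K m m').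
  apply: (@is_derive_eq _ _ _ _ _ _ _ _
    (is_deriveM (is_deriveM (dc K m) (dc K m')) (is_derive_cst (G K m m') t 1))).
  by rewrite scaler0 add0r /GRing.scale /= mulrC.
apply: (@is_derive_eq _ _ _ _ _ _ _ _
  (is_derive_big _ (fun K => is_derive_big _ (fun m => is_derive_big _ (dcc K m))))).
rewrite mulr_sumr; apply: eq_bigr => K _.
have -> : tri_int K (du t K * u t K) =
    \sum_m \sum_m' derive1 (c K m) t * c K m' t * G K m m'.
  rewrite (Vh_expand K (sol_Vh solu (ltW t0))).
  exact: (tri_int_product K (fun m => derive1 (c K m) t) (fun m => c K m t)).
rewrite mulr_natl mulr2n.
(* The product rule gives two sums that differ by exchanging [m] and [m']; the moments are
   symmetric, whence the factor 2. *)
rewrite [X in _ = X + _]exchange_big -big_split /=.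
apply: eq_bigr => m _; rewrite -big_split /=; apply: eq_bigr => m' _.
by rewrite mulrDl /G (mulrC (mpolyX R m')) (mulrC (c K m t)) (mulrC (c K m' t)).
Qed.

Lemma side_int_edge_term (t : R) s : 0 < t ->
  side_integrable s (edge_term A b0 b0v b1 (u t) s) /\
  side_int s (edge_term A b0 b0v b1 (u t) s) =
    side_int s (flux_term A b0 b1 (u t) (u t) s)
    + side_int s (test_flux_term A b0v b1 (u t) (u t) s).
Proof.
case: s => K i t0; have [_ /(_ i)[if_ it_]] := sol_integrable solu K t0 (sol_Vh solu (ltW t0)).
have mI : measurable (`[0, 1]%classic : set (measurableTypeR R)) by exact: measurable_itv.
split; last by rewrite /side_int -mulrDr -(RintegralD mI if_ it_).
by apply: eq_integrable (integrableD mI if_ it_).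
Qed.

(** Tested with [u t], the scheme equates the integral of u_t u plus a nonnegative diffusion term
    with the edge terms of the element, whose total over the mesh is nonpositive. *)
Lemma energy_dissipation (t : R) : 0 < t -> \sum_K tri_int K (du t K * u t K) <= 0.
Proof.
move=> t0; have := sum_side_int_le0 posA leb (fun s => (side_int_edge_term s t0).1); apply: le_trans.
rewrite (_ : \sum_s side_int s (edge_term A b0 b0v b1 (u t) s) =
  \sum_K \sum_i side_int (K, i) (edge_term A b0 b0v b1 (u t) (K, i))); last first.
  by rewrite pair_bigA; apply: eq_bigr => -[].
apply: ler_sum => K _; have := sol_scheme solu K t0 (sol_Vh solu (ltW t0)).
rewrite (_ : \int[leb2 R]_(p in tri K) (time_deriv u t K p * evalp (u t K) p) =
    tri_int K (du t K * u t K)); last first.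
  by apply: eq_Rintegral => p _; rewrite evalpM time_derivE.
have diff0 : 0 <= \int[leb2 R]_(p in tri K) diffusion_term A (u t) (u t) K p.
  by apply: Rintegral_ge0 => p _; rewrite /diffusion_term dotC; exact: posdef_ge0.
rewrite (eq_bigr _ (fun i _ => (side_int_edge_term (K, i) t0).2)) big_split /=.
by move: diff0; set X := \int[leb2 R]_(p in tri K) diffusion_term _ _ _ _ _; move=> X0; lra.
Qed.

Lemma continuous_energy : {within `[0, +oo[, continuous energy}.
Proof.
have cc K m : {within `[0, +oo[, continuous (c K m)} by exact: sol_continuous solu K m.
apply: continuous_big => K; apply: continuous_big => m; apply: continuous_big => m'.
by move=> x; exact: (continuousM (continuousM (cc K m x) (cc K m' x)) (@cst_continuous _ _ _ x)).
Qed.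

(** The sign of the derivative is known at positive times; continuity up to 0 brings in the initial
    time. *)
Lemma energy_nonincreasing (T : R) : 0 <= T -> energy T <= energy 0.
Proof.
move=> T0; apply: (@ler0_derive1_nincry _ _ 0) => //; last exact: continuous_energy.
- move=> x; rewrite in_itv /= andbT => x0.
  exact: (@ex_derive _ _ _ _ _ _ _ (is_derive_energy x0)).
- move=> x; rewrite in_itv /= andbT => x0.
  rewrite derive1E (@derive_val _ _ _ _ _ _ _ (is_derive_energy x0)).
  by rewrite mulr_ge0_le0// energy_dissipation.
Qed.

(** The projection tested with the constant 1 contains the integrability of [U0] on each element. *)
Lemma initial_measurable (K : elt M) :
  measurable_fun (tri K : set (plane R)) U0.
Proof.
have V1 : Vh k ((fun=> 1) : broken M) by move=> ?; rewrite msize1.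
have [iU0 _] := sol_init solu K V1.
apply/measurable_EFinP; apply: eq_measurable_fun (measurable_int _ iU0) => p _ /=.
by rewrite /evalp meval1 mulr1.
Qed.

(* Testing the projection with u(0) itself: 2 U0 u(0) - u(0)^2 <= U0^2. *)
Lemma initial_energy K :
  ((tri_int K (u 0 K ^+ 2))%:E <= \int[leb2 R]_(p in tri K) ((U0 p) ^+ 2)%:E)%E.
Proof.
have mK := measurable_tri K; have Vu0 := sol_Vh solu (lexx 0).
have [iU0u e0] := sol_init solu K Vu0; have mU0 := @initial_measurable K.
have iu2 := integrable_evalp K (u 0 K ^+ 2).
pose g p := 2 * (U0 p * evalp (u 0 K) p) - evalp (u 0 K ^+ 2) p.
have ig : (leb2 R).-integrable (tri K) (fun p => (g p)%:E).
  apply: eq_integrable (integrableB mK (integrableZl mK 2 iU0u) iu2) => // p _.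
(* By the projection, U0 u(0) and u(0)^2 have the same integral, so [g] integrates to the latter. *)
have -> : (tri_int K (u 0 K ^+ 2))%:E = (\int[leb2 R]_(p in tri K) (g p)%:E)%E.
  rewrite -(fineK (integrable_fin_num mK ig)) -[fine _]/(Rintegral _ _ _).
  congr EFin.
  have e2 : \int[leb2 R]_(p in tri K) (evalp (u 0 K) p * evalp (u 0 K) p) =
      tri_int K (u 0 K ^+ 2).
    by apply: eq_Rintegral => p _; rewrite expr2 evalpM.
  rewrite (RintegralB mK (integrableZl mK 2 iU0u) iu2) (RintegralZl 2 mK iU0u) -e0 e2.
  by rewrite -/(tri_int K (u 0 K ^+ 2)); lra.
(* The integral of U0^2 may be infinite, so [g] is replaced by its positive part and nonnegative
   integrals are compared. *)
rewrite integralE.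
apply: (@le_trans _ _ (\int[leb2 R]_(p in tri K) (fun p => (g p)%:E)^\+ p)%E).
  by apply: geeDl; rewrite leeNl oppe0; apply: integral_ge0.
apply: ge0_le_integral => //.
- by apply: measurable_funepos; exact: measurable_int ig.
- by apply/measurable_EFinP; apply: measurable_funX.
- move=> p _; rewrite funeposE ge_max; apply/andP; split; rewrite lee_fin ?sqr_ge0// /g.
  by rewrite !expr2 evalpM; have := sqr_ge0 (U0 p - evalp (u 0 K) p); rewrite expr2; lra.
Qed.

End Energy.

(** * Integrals over the domain *)

(** The integral of a nonnegative function is a supremum over the simple functions below it, and a
    larger function has more of them. This serves integrands on the domain whose measurability is
    not at hand. *)
Lemma ge0_le_integralT d (T : measurableType d) (R : realType)
    (mu : {measure set T -> \bar R}) (f g : T -> \bar R) :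
  (forall x, 0 <= f x)%E -> (forall x, f x <= g x)%E ->
  (\int[mu]_x f x <= \int[mu]_x g x)%E.
Proof.
move=> f0 fg; have g0 x : (0 <= g x)%E by apply: le_trans (fg x).
rewrite !ge0_integralTE//; apply: le_ereal_sup => _ [h hf <-]; exists h => //= x.
exact: le_trans (fg x).
Qed.

Section Domain.
Context {R : realType} (M : mesh R) (Omega : set (R * R)).
Hypothesis partition : mesh_partition M Omega.

(** At a point of the domain the left integrand is the square for one element containing it, hence
    one of the nonnegative terms on the right; such an element exists because the triangles cover
    the closure. *)
Lemma Vh_fun_integral_le (w : broken M) :
  (\int[leb2 R]_(p in Omega) ((Vh_fun w p) ^+ 2)%:E
   <= \sum_K (tri_int K (w K ^+ 2))%:E)%E.
Proof.
have mK := @measurable_tri R M.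
pose f K : R * R -> \bar R := (EFin \o evalp (w K ^+ 2)) \_ (tri K).
have f0 K p : (0 <= f K p)%E.
  by rewrite /f patchE; case: ifP => // _; rewrite lee_fin expr2 evalpM -expr2 sqr_ge0.
have mf K : measurable_fun [set: plane R] (f K).
  apply/measurable_restrict => //; rewrite ?setTI//.
  exact: measurable_int (integrable_evalp K (w K ^+ 2)).
have -> : (\sum_K (tri_int K (w K ^+ 2))%:E = \int[leb2 R]_p (\sum_K f K p))%E.
  rewrite ge0_integral_sum//; apply: eq_bigr => K _.
  rewrite -integral_mkcond.
  by rewrite -(fineK (integrable_fin_num (mK K) (integrable_evalp K (w K ^+ 2)))).
rewrite integral_mkcond; apply: ge0_le_integralT => p; rewrite patchE.
  by case: ifP => // _; rewrite lee_fin sqr_ge0.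
case: ifP => [|_]; last exact: sume_ge0.
rewrite inE => Op; rewrite /Vh_fun; case: pickP => [K /asboolP Kp|noK].
  rewrite (bigD1 K)//= {1}/f patchE ifT ?inE//=.
  by rewrite -[leLHS]adde0 expr2 -evalpM -expr2 leeD2l// sume_ge0.
have [_ clO _] := partition.
have : closure Omega p by exact: subset_closure.
by rewrite clO => -[K _ Kp]; have := noK K; rewrite asboolT.
Qed.

(** Up to null edges the triangles may be taken open. They are then disjoint and contained in the
    domain, so at each point at most one term is nonzero. *)
Lemma sum_tri_integral_le (g : R * R -> R) :
  (forall K : elt M, measurable_fun (tri K : set (plane R)) g) ->
  (\sum_(K : elt M) \int[leb2 R]_(p in tri K) ((g p) ^+ 2)%:E
   <= \int[leb2 R]_(p in Omega) ((g p) ^+ 2)%:E)%E.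
Proof.
move=> mg; have mg2 (K : elt M) :
    measurable_fun (tri K : set (plane R)) (fun p => ((g p) ^+ 2)%:E).
  by apply/measurable_EFinP; exact: measurable_funX.
pose f (K : elt M) : R * R -> \bar R := (fun p => ((g p) ^+ 2)%:E) \_ (open_tri K).
have f0 K p : (0 <= f K p)%E.
  by rewrite /f patchE; case: ifP => // _; rewrite lee_fin sqr_ge0.
have mf K : measurable_fun [set: plane R] (f K).
  apply/measurable_restrict => //; rewrite ?setTI//; first exact: measurable_open_tri.
  exact: measurable_funS (measurable_tri K) (@open_tri_sub _ _ K) (mg2 K).
rewrite (eq_bigr (fun K => \int[leb2 R]_p f K p)%E); last first.
  move=> K _; rewrite -integral_mkcond; apply: ge0_integral_open_tri; first exact: mg2.
  by move=> p _; rewrite lee_fin sqr_ge0.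
rewrite -ge0_integral_sum// [leRHS]integral_mkcond.
apply: ge0_le_integralT => p; first exact: sume_ge0.
have [[K Kp]|noK] := pselect (exists K : elt M, open_tri K p); last first.
  rewrite big1 => [|K _]; last first.
    by rewrite /f patchE ifF//; apply/negP; rewrite inE => Kp; apply: noK; exists K.
  by rewrite patchE; case: ifP => // _; rewrite lee_fin sqr_ge0.
have [_ _ intO] := partition.
rewrite (bigD1 K)//= big1 ?adde0 => [|K' K'K].
  by rewrite /f !patchE !ifT// inE//; exact: intO (open_tri_interior Kp).
by rewrite /f patchE ifF//; apply/negP; rewrite inE => /(open_tri_disjoint _ Kp); apply; rewrite eq_sym.
Qed.
End Domain.

Theorem theorem4p1 (R : realType) (Omega : set (R * R)) (M : mesh R)
    (kappa : R) (k : nat) (A : R -> 'M[R]_2) (beta0 beta0v beta1 : R)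
    (U0 : R * R -> R) (u : R -> broken M) :
  mesh_partition M Omega ->
  shape_regular M kappa ->
  (forall z : R, posdef (A z)) ->
  DDG_solution k A (-1) beta0 beta0v beta1 U0 u ->
  beta0v <= beta0 ->
  forall T : R, 0 <= T ->
    (\int[leb2 R]_(p in Omega) ((Vh_fun (u T) p) ^+ 2)%:E
     <= \int[leb2 R]_(p in Omega) ((U0 p) ^+ 2)%:E)%E.
Proof.
move=> partition _ posA solu leb T T0.
apply: le_trans (Vh_fun_integral_le partition (u T)) _.
rewrite sumEFin -(energyE solu T0).
apply: (@le_trans _ _ (energy k u 0)%:E).
  by rewrite lee_fin (energy_nonincreasing posA leb solu).
rewrite (energyE solu (lexx 0)) -sumEFin.
apply: le_trans (sum_tri_integral_le partition _); last first.
  by move=> K; exact: (initial_measurable solu).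
by apply: lee_sum => K _; exact: (initial_energy solu).
Qed.
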